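(* If a (discrete) group $\Gamma$ is amenable or residually finite, then $\Gamma$ has an essentially free amenable action on some set $X$.
   Context: An action of $\Gamma$ on a set $X$ is an essentially free amenable action if there exists a $\Gamma$-invariant finitely additive probability measure $\mu$ defined on all subsets of $X$ such that for every $1\ne g\in\Gamma$ the fixed point set $\mathrm{Fix}(g)\subseteq X$ satisfies $\mu(\mathrm{Fix}(g))=0$. *)

(* Defs.v *)
From mathcomp Require Import all_boot ssralg ssrnum fingroup.
From mathcomp Require Import boolp classical_sets reals.

Set Implicit Arguments.
Unset Strict Implicit.
Unset Printing Implicit Defensive.

Local Open Scope classical_set_scope.

Record fa_probability (R : realType) (X : Type) (mu : set X -> R) : Prop := {
  fa_probability_ge0 : forall A, (0 <= mu A)%R;
  fa_probability_setT : mu [set: X] = 1%R;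
  fa_probability_additive : forall A B,
    A `&` B = set0 -> mu (A `|` B) = (mu A + mu B)%R
}.

Record group_action (G : groupType) (X : Type) (act : G -> X -> X) : Prop := {
  group_action1 : forall x, act 1%g x = x;
  group_actionM : forall g h x, act (g * h)%g x = act g (act h x)
}.

Definition action_invariant (R : realType) (G : groupType) (X : Type)
    (act : G -> X -> X) (mu : set X -> R) : Prop :=
  forall (g : G) (A : set X), mu (act g @` A) = mu A.

Definition fixed_points (G : groupType) (X : Type) (act : G -> X -> X)
    (g : G) : set X :=
  [set x | act g x = x].

(* Amenability of a discrete group: a finitely additive probability measure on
   all its subsets that is invariant under left translation. *)
Definition amenable (R : realType) (G : groupType) : Prop :=
  exists mu : set G -> R,
    fa_probability mu /\ action_invariant (fun g x : G => (g * x)%g) mu.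

(* [{multiplicative G -> H}] only asks for products to be preserved; between
   groups these are exactly the group homomorphisms. *)
Definition residually_finite (G : groupType) : Prop :=
  forall g : G, g <> 1%g ->
    exists (H : finGroupType) (phi : {multiplicative G -> H}), phi g <> 1%g.

Definition essentially_free_amenable_action (R : realType) (G : groupType)
    (X : Type) (act : G -> X -> X) : Prop :=
  group_action act /\
  exists mu : set X -> R,
    [/\ fa_probability mu,
        action_invariant act mu
      & forall g : G, g <> 1%g -> mu (fixed_points act g) = 0%R].

(* Main.v *)
Require Import Defs.
From mathcomp Require Import all_boot ssralg ssrnum fingroup.
From mathcomp Require Import boolp classical_sets reals.
From mathcomp Require Import order interval perm gproduct.
From mathcomp Require Import topology normedtype.

(** An amenable group acts essentially freely on itself by translation, since a
    nontrivial element has no fixed points.  If [G] is residually finite, every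
    finite set [s] of nontrivial elements survives in a single finite quotient
    [H s]; let [G] act on the disjoint union of these quotients.  Ordering the
    sets [s] by inclusion, an ultralimit of the uniform measures on the [H s] is
    an invariant mean, and it does not charge the fixed points of [g], because
    [g] acts without fixed points on [H s] as soon as [s] contains [g]. *)

Set Implicit Arguments.
Unset Strict Implicit.
Unset Printing Implicit Defensive.

Import GRing.Theory Num.Theory.
Import numFieldNormedType.Exports.

Local Open Scope classical_set_scope.

Lemma fa_probability_le1 (R : realType) (X : Type) (mu : set X -> R)
    (A : set X) : fa_probability mu -> (mu A <= 1)%R.
Proof.
move=> mup; have := fa_probability_additive mup (setICr A).
rewrite setUCr (fa_probability_setT mup) => ->.
by rewrite lerDl (fa_probability_ge0 mup).
Qed.

Lemma fa_probability_set0 (R : realType) (X : Type) (mu : set X -> R) :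
  fa_probability mu -> mu set0 = 0%R.
Proof.
move=> mup; apply: (@addrI _ (mu set0)).
by rewrite -(fa_probability_additive mup) ?setI0 // setU0 addr0.
Qed.

(** Compactness yields a cluster point [x]. For a neighbourhood [V] of [x], the ultrafilter contains
    the preimage of [V] or its complement, and the latter would contradict clustering at [x]. *)
Lemma cvg_ultra_compact (T : topologicalType) (I : Type) (U : set_system I)
    (f : I -> T) (K : set T) :
  UltraFilter U -> compact K -> (forall i, K (f i)) ->
  exists x : T, f i @[i --> U] --> x.
Proof.
move=> UU cptK fK; have UF : ProperFilter U := ultra_proper.
have fUK : (f i @[i --> U]) K by apply: nearW.
have [x [_ clx]] := cptK _ _ fUK.
exists x => V xV; have [//|nV] := in_ultra_setVsetC (f @^-1` V) UU.
by have [y []] := clx (~` V) V nV xV.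
Qed.

(** All values lie in the compact segment from 0 to 1, so every set has a limit along [U]; the
    axioms pass to the limit by continuity of addition and uniqueness of limits. *)
Lemma fa_probability_ultralimit (R : realType) (I X : Type)
    (U : set_system I) (mu : I -> set X -> R) :
  UltraFilter U -> (forall i, fa_probability (mu i)) ->
  exists2 nu : set X -> R, fa_probability nu &
    forall A, mu i A @[i --> U] --> nu A.
Proof.
move=> UU mup; have UF : ProperFilter U := ultra_proper.
have mu_cvg A : exists x : R, mu i A @[i --> U] --> x.
  apply: cvg_ultra_compact (@segment_compact R 0%R 1%R) _ => i /=.
  by rewrite in_itv /= (fa_probability_ge0 (mup i)) fa_probability_le1.
have [nu nuP] := choice mu_cvg.
have nu_lim A x : mu i A @[i --> U] --> x -> nu A = x.
  by move=> Ax; apply: (cvg_unique (@Rhausdorff R) (nuP A) Ax).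
exists nu => //; split => [A||A B AB].
- by apply: cvgr_to_ge (nuP A) _; apply: nearW => i; apply: fa_probability_ge0.
- apply: nu_lim; apply: cvg_near_cst.
  by apply: nearW => i; apply: fa_probability_setT.
- apply: nu_lim.
  rewrite (_ : (fun i => mu i (A `|` B)) = (fun i => mu i A + mu i B)%R).
    exact: cvgD.
  by apply/funext => i; apply: fa_probability_additive.
Qed.

(** Induction on [s]: a quotient detecting the new element is multiplied with the one obtained for
    the tail. *)
Lemma residually_finite_seq (G : groupType) (s : seq G) :
  residually_finite G ->
  exists (H : finGroupType) (phi : G -> H),
    {morph phi : x y / (x * y)%g} /\
    {in s, forall g, g <> 1%g -> phi g <> 1%g}.
Proof.
move=> rfG; elim: s => [|g s [H [phi [phiM phis]]]].
  (* With nothing to detect, the trivial map to any finite group works. *)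
  by exists {perm 'I_1}, (fun=> 1%g); split => // x y; rewrite mulg1.
have [->|/eqP/rfG[K [psi psig]]] := eqVneq g 1%g.
  by exists H, phi; split => // x; rewrite inE => /orP[/eqP->//|/phis].
exists (K * H)%type, (fun x => (psi x, phi x)); split => [x y|x].
  by rewrite gmulfM phiM.
rewrite inE => /orP[/eqP-> _ [/psig//]|xs x1 [_]].
exact: phis.
Qed.

Definition uniform_measure (R : realType) (H : finGroupType) (A : set H) : R :=
  (#|A|%:R / #|H|%:R)%R.

Lemma uniform_measure_fa_probability (R : realType) (H : finGroupType) :
  fa_probability (@uniform_measure R H).
Proof.
split => [A||A B AB]; rewrite /uniform_measure.
- by rewrite divr_ge0.
- rewrite (_ : #|[set: H]| = #|H|).
    by rewrite divff// pnatr_eq0 -lt0n; apply/card_gt0P; exists 1%g.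
  by apply: eq_card => h; rewrite in_setT.
- rewrite -mulrDl -natrD -cardUI (_ : #|[predI A & B]| = 0) ?addn0.
    by congr (_%:R / _)%R; apply: eq_card => h; rewrite in_setU inE.
  by apply: eq_card0 => h; rewrite inE -in_setI AB in_set0.
Qed.

(** Translation is injective, hence preserves cardinality. *)
Lemma uniform_measure_translate (R : realType) (H : finGroupType) (k : H)
    (A : set H) :
  uniform_measure R (mulg k @` A) = uniform_measure R A.
Proof.
congr (_%:R / _)%R; rewrite -(card_image (mulgI k) (mem A)).
apply: eq_card => h; apply/idP/fintype.imageP.
  move=> /set_mem[a Aa <-].
  by exists a => //; apply: mem_set.
by case=> a /set_mem Aa ->; apply: mem_set; exists a.
Qed.

Lemma residually_finite_action (R : realType) (G : groupType) :
  residually_finite G ->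
  exists (X : Type) (act : G -> X -> X), essentially_free_amenable_action R act.
Proof.
move=> rfG.
(* The group and its map are packed into one dependent pair so that [choice] selects both at
   once. *)
have quot (s : seq G) : exists Q : {H : finGroupType & G -> H},
    {morph projT2 Q : x y / (x * y)%g} /\
    {in s, forall g, g <> 1%g -> projT2 Q g <> 1%g}.
  have [H [phi Hphi]] := residually_finite_seq s rfG.
  by exists (existT _ H phi).
have [Q QP] := choice quot.
pose H s := projT1 (Q s); pose phi s : G -> H s := projT2 (Q s).
have phiM s : {morph phi s : x y / (x * y)%g} by case: (QP s).
have phi_neq1 (s : seq G) g : g \in s -> g <> 1%g -> phi s g <> 1%g.
  by case: (QP s) => _; apply.
have phi1 s : phi s 1%g = 1%g.
  by apply: (@mulgI _ (phi s 1%g)); rewrite -phiM !mulg1.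
pose X := {s : seq G & H s}.
pose act g (x : X) : X := existT _ (tag x) (phi (tag x) g * tagged x)%g.
exists X, act; split.
  split => [[s h]|g k [s h]]; rewrite /act /=; first by rewrite phi1 mul1g.
  by rewrite phiM mulgA.
pose fiber s (A : set X) : set (H s) := [set h | A (existT _ s h)].
(* This is the uniform measure on [H s], pushed forward to [X]. *)
pose mu s (A : set X) := uniform_measure R (fiber s A).
have mup s : fa_probability (mu s).
  have [ge0 tot add] := uniform_measure_fa_probability R (H s).
  split => [A||A B AB]; [exact: ge0|exact: tot|].
  apply: add; rewrite -subset0 => h ABh.
  by have : (A `&` B) (existT _ s h) by []; rewrite AB.
pose above (s : seq G) : set (seq G) := [set t | {subset s <= t}].
(* The sets [above s] form a filter base: [above (s ++ t)] lies in both [above s] and [above t], and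
   [s] itself belongs to [above s]. *)
have aboveF : ProperFilter (filter_from setT above).
  apply: filter_from_proper => [|s _]; last by exists s.
  apply: filter_from_filter => [|s t _ _]; first by exists [::].
  exists (s ++ t) => // u stu; split=> g gs; apply: stu.
    by rewrite mem_cat gs.
  by rewrite mem_cat gs orbT.
have [U [UU aboveU]] := ultraFilterLemma aboveF.
have UF : ProperFilter U := ultra_proper.
have [nu nup nu_lim] := fa_probability_ultralimit UU mup.
exists nu; split => // [g A|g g1].
  apply: (cvg_unique (@Rhausdorff R) (nu_lim _)).
  (* Each [mu s] is already invariant: on the fiber over [s], [g] acts as left translation by
     [phi s g]. *)
  suff -> : (fun s => mu s (act g @` A)) = (fun s => mu s A) by exact: nu_lim.
  apply/funext => s; rewrite -[RHS](uniform_measure_translate R (phi s g)).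
  congr (uniform_measure R _); apply/seteqP; split => h /=.
    (* The action preserves tags, so a preimage of a point over [s] also lies over [s]; eliminating
       [ts] lets the second components be compared. *)
    case=> [[t k] Ak] E; have /= ts := congr1 tag E.
    case: _ / ts h E => h /eqP; rewrite eq_Tagged /= => /eqP <-.
    by exists k.
  by case=> k Ak <-; exists (existT _ s k).
apply: (cvg_unique (@Rhausdorff R) (nu_lim _)).
apply: cvg_near_cst.
(* [U]-almost every [s] contains [g], and for such [s] a fixed point [h] would force [phi s g] to be
   1 by cancellation. *)
have : U (above [:: g]) by apply: aboveU; exists [:: g].
apply: filterS => s /(_ g (mem_head _ _)) gs.
rewrite -[RHS](fa_probability_set0 (uniform_measure_fa_probability R (H s))).
congr (uniform_measure R _); rewrite -subset0 => h /= /eqP.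
rewrite eq_Tagged /= => /eqP E; apply: (phi_neq1 s g gs g1).
by apply: (@mulIg _ h); rewrite mul1g.
Qed.

Theorem proposition4p3 (R : realType) (Gamma : groupType)
    (hGamma : amenable R Gamma \/ residually_finite Gamma) :
  exists (X : Type) (act : Gamma -> X -> X),
    essentially_free_amenable_action R act.
Proof.
case: hGamma => [[mu [mup mu_inv]]|]; last exact: residually_finite_action.
exists Gamma, (fun g x => (g * x)%g); split.
  by split => [x|g h x]; rewrite ?mul1g ?mulgA.
exists mu; split => // g g1.
rewrite (_ : fixed_points _ g = set0) ?(fa_probability_set0 mup) //.
rewrite -subset0 => x /= gx; apply: g1.
by apply: (@mulIg _ x); rewrite mul1g.
Qed.
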